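(* Let $\Lambda\colon\mathbb{R}\to[0,1]$. (a) $Q_\Lambda^+$ is weakly upper semicontinuous (on all of $\mathcal M$) if and only if $\Lambda(x)\ge\liminf_{y\downarrow x}\Lambda(y)$ for all $x\in\mathbb{R}$. (b) Suppose additionally that $\Lambda$ is right lower semicontinuous, i.e. $\liminf_{y\downarrow x}\Lambda(y)\ge\Lambda(x)$ for all $x\in\mathbb{R}$, and that $Q_\Lambda^+$ is weakly upper semicontinuous. Then $Q_\Lambda^+$ is weakly continuous if and only if there exists a threshold $a\in[-\infty,\infty]$ such that $\Lambda\equiv1$ on $(-\infty,a)$ and $\Lambda$ is strictly decreasing on $[a,\infty)$ (where for $a=-\infty$ the first condition is void and the second means strictly decreasing on $\mathbb{R}$, and for $a=\infty$ the condition means $\Lambda\equiv1$ on $\mathbb{R}$).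
   Context: $\mathcal M$ is the set of cumulative distribution functions on $\mathbb{R}$. For $F\in\mathcal M$, $Q_\Lambda^+(F):=\inf\{x\in\mathbb{R}\mid F(x)>\Lambda(x)\}\in[-\infty,\infty]$, with $\inf\varnothing=\infty$. A sequence $(F_n)\subseteq\mathcal M$ converges weakly to $F\in\mathcal M$ if $F_n(x)\to F(x)$ at all continuity points $x$ of $F$. A functional $\rho\colon\mathcal M\to[-\infty,\infty]$ is weakly upper semicontinuous if $\limsup_{n\to\infty}\rho(F_n)\le\rho(F)$ whenever $F_n\to F$ weakly with $F_n,F\in\mathcal M$; weakly lower semicontinuous if $-\rho$ is weakly upper semicontinuous; weakly continuous if it is both. *)

(* Defs.v *)
From mathcomp Require Import all_boot all_order all_algebra.
From mathcomp Require Import all_classical all_reals all_analysis.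

Set Implicit Arguments.
Unset Strict Implicit.
Unset Printing Implicit Defensive.

Import Order.TTheory GRing.Theory Num.Theory.
Import numFieldNormedType.Exports.

Local Open Scope classical_set_scope.
Local Open Scope ring_scope.

(* Nondecreasing right-continuous functions with limits 0 at -oo and 1 at +oo;
   two such objects with the same underlying function are equal by proof
   irrelevance. *)
Definition cdfs (R : realType) : Type := cumulativeBounded (0 : R) (1 : R).

Definition cdf_fun (R : realType) (F : cdfs R) : R -> R := F.
Coercion cdf_fun : cdfs >-> Funclass.

(* [ereal_inf set0] is [+oo]. *)
Definition Qplus (R : realType) (Lam : R -> R) (F : cdfs R) : \bar R :=
  ereal_inf [set x%:E | x in [set x : R | Lam x < F x]].

Definition weak_cvg (R : realType) (Fn : nat -> cdfs R) (F : cdfs R) : Prop :=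
  forall x : R, {for x, continuous (F : R -> R)} ->
    Fn n x @[n --> \oo] --> F x.

Definition weakly_usc (R : realType) (rho : cdfs R -> \bar R) : Prop :=
  forall (Fn : nat -> cdfs R) (F : cdfs R), weak_cvg Fn F ->
    (limn_esup (fun n => rho (Fn n)) <= rho F)%E.

Definition weakly_lsc (R : realType) (rho : cdfs R -> \bar R) : Prop :=
  weakly_usc (fun F => - rho F)%E.

Definition weakly_continuous (R : realType) (rho : cdfs R -> \bar R) : Prop :=
  weakly_usc rho /\ weakly_lsc rho.

(* [x^'+] is the filter of punctured right neighbourhoods of [x], so the value
   [f x] itself plays no role. *)
Definition right_liminf (R : realType) (f : R -> R) (x : R) : \bar R :=
  limf_einf (EFin \o f) x^'+.

Definition right_lsc (R : realType) (f : R -> R) : Prop :=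
  forall x : R, ((f x)%:E <= right_liminf f x)%E.

(* Main.v *)
Require Import Defs.
From mathcomp Require Import all_boot all_order all_algebra.
From mathcomp Require Import all_classical all_reals all_analysis.

(** All counterexamples are two-step cdfs, equal to 0 before [p], to [c] on
[p, q) and to 1 from [q] on.  For (a), if [Lam x < c < Lam] on (x, q), moving
the first jump from right of [x] to [x] makes the quantile drop from at least
[q] to [x].  For (b), lower semicontinuity of the quantile forces two things:
letting the height [c] decrease to [Lam x < 1], there are points arbitrarily
close to [x] on its right where [Lam] is below [Lam x]; letting the first jump
increase to [x], [Lam] is left lower semicontinuous at [x].  A supremum argument
turns these local facts into strict decrease once [Lam] is below 1.  Conversely,
strict decrease gives a gap between [F z] and [Lam x] for x < z, and this gap
survives weak convergence at a continuity point [z] of [F]. *)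

Import Order.TTheory GRing.Theory Num.Theory.
Import numFieldNormedType.Exports.

Set Implicit Arguments.
Unset Strict Implicit.

Local Open Scope classical_set_scope.
Local Open Scope ring_scope.

(** * One-sided liminf and sequential limsup *)

Section liminf_limsup.
Context {R : realType}.
Implicit Types (f : R -> R) (u : (\bar R)^nat).

Lemma right_liminf_lt f (x c d : R) : 0 < d ->
  (right_liminf f x < c%:E)%E -> exists2 y, x < y < x + d & f y < c.
Proof.
move=> d0; rewrite /right_liminf limf_einfE => fc.
have : (ereal_inf ((EFin \o f) @` [set y | (x < y < x + d)%R]) < c%:E)%E.
  apply: le_lt_trans fc; apply: ereal_sup_ubound => /=.
  exists [set y | x < y < x + d] => //.
  near=> y => /=; apply/andP; split; near: y; first exact: nbhs_right_gt.
  by apply: nbhs_right_lt; rewrite ltrDl.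
by move=> /ereal_inf_lt[_ [y /= xy <-]]; rewrite lte_fin => ?; exists y.
Unshelve. all: by end_near. Qed.

Lemma right_liminf_gt f (x c : R) : (c%:E < right_liminf f x)%E ->
  exists2 d, 0 < d & forall y, x < y < x + d -> c < f y.
Proof.
rewrite /right_liminf limf_einfE => /ereal_sup_gt[_ [V + <-] cV].
move=> [d /= d0 xdV]; exists d => // y /andP[xy yxd].
rewrite -lte_fin; apply: lt_le_trans cV _; apply: ereal_inf_lbound.
exists y => //; apply: xdV => //=.
by rewrite distrC gtr0_norm ?subr_gt0// ltrBlDl.
Qed.

Lemma limn_esup_le u (b : \bar R) :
  (\forall n \near \oo, u n <= b)%E -> (limn_esup u <= b)%E.
Proof.
move=> ub; apply: ge_ereal_inf; exists (ereal_sup (u @` [set n | (u n <= b)%E])).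
  by exists [set n | (u n <= b)%E].
by apply: ge_ereal_sup => _ [n /= ? <-].
Qed.

Lemma limn_esup_ge u (b : \bar R) :
  (forall n, b <= u n)%E -> (b <= limn_esup u)%E.
Proof.
move=> bu; apply: le_ereal_inf_tmp => _ [V [N _ NV] <-].
apply: le_trans (bu N) _; apply: ereal_sup_ubound; exists N => //.
by apply: NV => /=.
Qed.

End liminf_limsup.

Lemma lte_exists_fin {R : realType} (a b : \bar R) : (a < b)%E ->
  exists2 r : R, (a < r%:E)%E & (r%:E < b)%E.
Proof.
case: a b => [a| |] [b| |]; rewrite ?lte_fin ?ltxx// => ab.
- by exists ((a + b) / 2); rewrite lte_fin midf_lt.
- by exists (a + 1); rewrite ?ltry// lte_fin ltrDl.
- by exists (b - 1); rewrite ?ltNyr// lte_fin ltrBlDl ltrDr.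
- by exists 0; rewrite ?ltry ?ltNyr.
Qed.

(** * Cdfs, their continuity points and the quantile *)

Section cdfs.
Context {R : realType}.
Implicit Types (F : cdfs R) (Lam : R -> R).

Lemma cdfs_nondecreasing F : nondecreasing (F : R -> R).
Proof. exact: cumulative_is_nondecreasing. Qed.

Lemma cdfs_le1 F x : F x <= 1.
Proof.
have /cvg_lim <- // := cumulativey F.
apply: limr_ge; first by apply/cvg_ex; exists 1; exact: cumulativey.
near=> y; apply: cdfs_nondecreasing; near: y; exact: nbhs_pinfty_ge.
Unshelve. all: by end_near. Qed.

(** The discontinuities of a monotone function are countable, hence Lebesgue-null, while []a, b[]
    has positive measure. *)
Lemma cdfs_continuous_exists F (a b : R) : a < b ->
  exists2 z, a < z < b & {for z, continuous (F : R -> R)}.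
Proof.
move=> ab.
have ndF : {in `[a, b] &, nondecreasing_fun F}.
  by move=> x y _ _; exact: cdfs_nondecreasing.
have cD := discontinuity_countable ndF.
have [z /= zab nDz] : exists2 z, z \in `]a, b[ & ~ discontinuity F z.
  apply: contrapT => noz.
  have : lebesgue_measure `]a, b[%classic = 0%E :> \bar R.
    apply: countable_lebesgue_measure0; apply: sub_countable cD.
    apply: subset_card_le => z zab; split => //.
    by apply: contrapT => nDz; apply: noz; exists z.
  rewrite lebesgue_measure_itv/= lte_fin ab -EFinD => -[].
  by move=> /eqP; rewrite subr_eq0 (gt_eqF ab).
exists z; first by rewrite in_itv in zab.
(* Avoiding [discontinuity] only excludes a jump between existing one-sided limits; their existence
   comes from right-continuity and monotonicity. *)
have Fr : F x @[x --> z^'+] --> F z by exact: cumulative_is_right_continuous.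
have Fl : cvg (F x @[x --> z^'-]).
  apply: nondecreasing_at_left_is_cvgr.
  - by near=> t => x y _ _; exact: cdfs_nondecreasing.
  - near=> t; exists (F z) => _ [x /= + <-].
    by rewrite in_itv/= => /andP[_ /ltW]; exact: cdfs_nondecreasing.
apply/left_right_continuousP; split => //.
suff <- : lim (F x @[x --> z^'-]) = F z by [].
apply: contrapT => /eqP lFz; apply: nDz; split => //.
  by apply/cvg_ex; exists (F z).
by rewrite (cvg_lim _ Fr).
Unshelve. all: by end_near. Qed.

Lemma Qplus_le Lam F x : Lam x < F x -> (Qplus Lam F <= x%:E)%E.
Proof. by move=> LFx; apply: ereal_inf_lbound; exists x. Qed.

Lemma Qplus_ge Lam F x : (forall y, y < x -> F y <= Lam y) ->
  (x%:E <= Qplus Lam F)%E.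
Proof.
move=> FL; apply: le_ereal_inf_tmp => _ [y /= LFy <-].
by rewrite lee_fin leNgt; apply/negP => /FL; rewrite leNgt LFy.
Qed.

Lemma Qplus_lt Lam F (b : \bar R) : (Qplus Lam F < b)%E ->
  exists2 x, (x%:E < b)%E & Lam x < F x.
Proof. by move=> /ereal_inf_lt[_ [x /= ? <-] ?]; exists x. Qed.

End cdfs.

(** * Two-step cdfs and their weak limits *)

Definition two_step {R : realType} (c p q x : R) : R :=
  if x < p then 0 else if x < q then c else 1.

Section two_step.
Context {R : realType} (c p q : R) (c01 : 0 <= c <= 1).

Lemma two_step_nondecreasing : nondecreasing (two_step c p q).
Proof.
move: c01 => /andP[c0 c1] x y xy; rewrite /two_step.
have [yp|py] := ltP y p; first by rewrite (le_lt_trans xy yp).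
have [yq|qy] := ltP y q; first by rewrite (le_lt_trans xy yq); case: ifP.
by do 2 case: ifP => // _.
Qed.

Lemma two_step_right_continuous : right_continuous (two_step c p q).
Proof.
move=> x; apply: cvg_near_cst; rewrite /two_step.
have pE : \forall y \near x^'+, (y < p) = (x < p).
  have [xp|px] := ltP x p; near=> y.
    by near: y; exact: nbhs_right_lt.
  by apply/negbTE; rewrite -leNgt (le_trans px)//; near: y; exact: nbhs_right_ge.
have qE : \forall y \near x^'+, (y < q) = (x < q).
  have [xq|qx] := ltP x q; near=> y.
    by near: y; exact: nbhs_right_lt.
  by apply/negbTE; rewrite -leNgt (le_trans qx)//; near: y; exact: nbhs_right_ge.
by near=> y; rewrite (near pE y)// (near qE y).
Unshelve. all: by end_near. Qed.

Lemma two_step_cvgNy : two_step c p q x @[x --> -oo] --> (0 : R).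
Proof.
apply: cvg_near_cst; near=> x; rewrite /two_step ifT//.
near: x; apply: nbhs_ninfty_lt; rewrite num_real.
Unshelve. all: by end_near. Qed.

Lemma two_step_cvgy : two_step c p q x @[x --> +oo] --> (1 : R).
Proof.
apply: cvg_near_cst; near=> x; rewrite /two_step !ifF//; apply/negbTE;
  rewrite -leNgt; near: x; apply: nbhs_pinfty_ge; rewrite num_real.
Unshelve. all: by end_near. Qed.

Definition two_step_cdf : cdfs R :=
  CumulativeBounded.Pack (CumulativeBounded.Class
    (isCumulativeBounded.phant_Build two_step_cvgNy two_step_cvgy)
    (isCumulative.phant_Build two_step_nondecreasing two_step_right_continuous)).

End two_step.

Arguments two_step_cdf {R c} p q c01.

Lemma two_step_cdfE {R : realType} (c p q : R) (c01 : 0 <= c <= 1) x :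
  two_step_cdf p q c01 x = two_step c p q x.
Proof. by []. Qed.

Section two_step_cvg.
Context {R : realType} (c : R) (c01 : 0 <= c <= 1).

(** The only critical point [p0] is a discontinuity of the limit, because [0 < c] and [p0 < q];
    elsewhere the values are eventually constant. *)
Lemma two_step_weak_cvg (p : nat -> R) (p0 q : R) : 0 < c -> p0 < q ->
  p n @[n --> \oo] --> p0 ->
  weak_cvg (fun n => two_step_cdf (p n) q c01) (two_step_cdf p0 q c01).
Proof.
move=> c0 pq pp x xC; apply: cvg_near_cst.
have [xp|px|xp] := ltgtP x p0.
- near=> n; rewrite !two_step_cdfE /two_step xp ifT//.
  by near: n; apply: cvgr_gt pp _ xp.
- near=> n; rewrite !two_step_cdfE /two_step [in RHS]ltNge (ltW px)/= ltNge ltW//.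
  by near: n; apply: cvgr_lt pp _ px.
- suff : \forall y \near x^'-, False by move=> /filter_ex[].
  move/cvg_at_left_filter: (xC).
  rewrite two_step_cdfE /two_step xp ltxx pq => /cvgr_gt /(_ 0 c0) F0.
  near=> y; have : 0 < two_step_cdf p0 q c01 y by near: y.
  have yp : y < p0 by near: y; exact: nbhs_left_lt.
  by rewrite two_step_cdfE /two_step yp ltxx.
Unshelve. all: by end_near. Qed.

End two_step_cvg.

(** * Upper semicontinuity of the quantile *)

Section semicontinuity.
Context {R : realType} (Lam : R -> R).
Hypothesis Lam01 : forall x, 0 <= Lam x <= 1.

Let Lam_ge0 x : 0 <= Lam x. Proof. by case/andP: (Lam01 x). Qed.
Let Lam_le1 x : Lam x <= 1. Proof. by case/andP: (Lam01 x). Qed.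

(** If [Lam x < F x], some [y] just right of [x] has [Lam y < F x], and a continuity point of [F]
    between them carries this to [Lam y < Fn n y] for large [n]. *)
Lemma Qplus_weakly_usc : (forall x, (right_liminf Lam x <= (Lam x)%:E)%E) ->
  weakly_usc (Qplus Lam).
Proof.
move=> Lamr Fn F FnF; apply: le_ereal_inf_tmp => _ [x /= LFx <-].
apply/lee_addgt0Pr => e e0.
have [y /andP[xy yxe] LyFx] : exists2 y, x < y < x + e & Lam y < F x.
  by apply: right_liminf_lt => //; apply: le_lt_trans (Lamr x) _; rewrite lte_fin.
have [z /andP[xz zy] Fz] := cdfs_continuous_exists F xy.
have /(cvgr_gt (F z)) FnFz := FnF z Fz.
apply: limn_esup_le; near=> n.
apply: (@le_trans _ _ y%:E); last by rewrite -EFinD lee_fin ltW.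
apply/Qplus_le/(@lt_le_trans _ _ (Fn n z)); last exact/cdfs_nondecreasing/ltW.
near: n; apply: FnFz; apply: (lt_le_trans LyFx).
exact/cdfs_nondecreasing/ltW.
Unshelve. all: by end_near. Qed.

Lemma right_liminf_le_of_usc : weakly_usc (Qplus Lam) ->
  forall x, (right_liminf Lam x <= (Lam x)%:E)%E.
Proof.
move=> usc x; rewrite leNgt; apply/negP.
move=> /lte_exists_fin[c Lc /right_liminf_gt[d d0 cL]].
rewrite lte_fin in Lc.
have xd : x < x + d by rewrite ltrDl.
have c0 : 0 < c by apply: le_lt_trans Lc.
have c01 : 0 <= c <= 1.
  rewrite ltW//=; apply: le_trans (Lam_le1 (x + d / 2)); apply/ltW/cL.
  by rewrite ltrDl ltrD2l divr_gt0//= gtr_pMr// invf_lt1// ltr1n.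
have xn : x + n.+1%:R^-1 @[n --> \oo] --> x.
  rewrite -[X in _ --> X]addr0; apply: cvgD; first exact: cvg_cst.
  exact: cvg_harmonic.
have := usc _ _ (two_step_weak_cvg (c01 := c01) c0 xd xn).
apply/negP; rewrite -ltNge.
(* The limit cdf jumps at [x] to [c], above [Lam x]. Before [x + d] each approximant is 0, or equals
   [c] at a point right of [x], where [Lam] exceeds [c]. *)
apply: (@le_lt_trans _ _ x%:E).
  by apply: Qplus_le; rewrite two_step_cdfE /two_step ltxx xd.
apply: (@lt_le_trans _ _ (x + d)%:E); first by rewrite lte_fin.
apply: limn_esup_ge => n; apply: Qplus_ge => y yxd.
rewrite two_step_cdfE /two_step yxd; case: ltP => // xy.
apply/ltW/cL; rewrite yxd andbT; apply: lt_le_trans xy.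
by rewrite ltrDl.
Qed.

(** * Lower semicontinuity from a threshold *)

Lemma threshold_weakly_lsc (a : \bar R) :
  (forall x : R, (x%:E < a)%E -> Lam x = 1) ->
  (forall x y : R, (a <= x%:E)%E -> x < y -> Lam y < Lam x) ->
  weakly_lsc (Qplus Lam).
Proof.
(* Here [- r] lies strictly below the quantile of [F]; it suffices that the quantiles of [Fn n] are
   eventually at least [- r]. *)
move=> La Ldecr Fn F FnF; rewrite leNgt; apply/negP => /lte_exists_fin[r].
rewrite lteNl -EFinN => /lte_exists_fin[w]; rewrite lte_fin => rw wF.
apply/negP; rewrite -leNgt.
have [z /andP[rz zw] Fz] := cdfs_continuous_exists F rw.
have /(cvgr_lt (F z)) FnFz := FnF z Fz.
have FLz : F z <= Lam z.
  rewrite leNgt; apply/negP => /Qplus_le; apply/negP; rewrite -ltNge.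
  by apply: le_lt_trans wF; rewrite lee_fin ltW.
apply: limn_esup_le.
(* If [- r <= a], then [Lam] is 1 left of [- r] and no cdf exceeds it there. *)
have [ra|ar] := leP (- r)%:E a.
  near=> n; rewrite leeNl -EFinN; apply: Qplus_ge => y yr.
  by rewrite La ?cdfs_le1//; apply: lt_le_trans ra; rewrite lte_fin.
have FzL : F z < Lam (- r).
  by apply: le_lt_trans FLz (Ldecr _ _ _ rz); exact: ltW.
near=> n; rewrite leeNl -EFinN; apply: Qplus_ge => y yr.
have [ya|ay] := ltP y%:E a; first by rewrite La ?cdfs_le1.
apply: (@le_trans _ _ (Fn n z)).
  by apply/cdfs_nondecreasing/ltW; exact: lt_trans rz.
apply: (@le_trans _ _ (Lam (- r))); last exact/ltW/Ldecr.
by apply/ltW; near: n; exact: FnFz.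
Unshelve. all: by end_near. Qed.

(** * A threshold from lower semicontinuity *)

Lemma Qplus_lsc_le (Fn : nat -> cdfs R) (F : cdfs R) (b : \bar R) :
  weakly_lsc (Qplus Lam) -> weak_cvg Fn F ->
  (forall n, Qplus Lam (Fn n) <= b)%E -> (Qplus Lam F <= b)%E.
Proof.
move=> lsc FnF Qb; rewrite -leeN2; apply: le_trans (lsc _ _ FnF).
by apply: limn_esup_ge => n; rewrite leeN2.
Qed.

(* The cdfs jumping at [x] to [c n], with [c n] decreasing to [Lam x], have
   quantile at most [x]; their weak limit jumps only to [Lam x]. *)
Lemma lsc_right_dip (x e : R) : weakly_lsc (Qplus Lam) -> Lam x < 1 -> 0 < e ->
  exists2 y, x < y < x + e & Lam y < Lam x.
Proof.
move=> lsc Lx1 e0.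
pose c n := Lam x + (1 - Lam x) * n.+1%:R^-1.
have c01 n : 0 <= c n <= 1.
  rewrite /c addr_ge0 ?mulr_ge0 ?subr_ge0//=.
  rewrite -lerBrDl ler_piMr ?subr_ge0// invf_le1 ?ler1n//.
have cL : c n @[n --> \oo] --> Lam x.
  rewrite -[X in _ --> X]addr0; apply: cvgD; first exact: cvg_cst.
  rewrite -[X in _ --> X](mulr0 (1 - Lam x)).
  by apply: cvgM; [exact: cvg_cst|exact: cvg_harmonic].
pose F := two_step_cdf x (x + e) (Lam01 x).
have FnF : weak_cvg (fun n => two_step_cdf x (x + e) (c01 n)) F.
  move=> z _; under eq_fun do rewrite two_step_cdfE; rewrite two_step_cdfE.
  rewrite /two_step; case: ltP => _; first exact: cvg_cst.
  case: ltP => _; last exact: cvg_cst.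
  exact: cL.
have /(Qplus_lsc_le lsc FnF) : forall n,
    (Qplus Lam (two_step_cdf x (x + e) (c01 n)) <= x%:E)%E.
  move=> n; apply: Qplus_le; rewrite two_step_cdfE /two_step ltxx ltrDl e0.
  by rewrite ltrDl mulr_gt0 ?subr_gt0.
(* Some [y < x + e] has [Lam y < F y]. It must lie right of [x], since [F] is 0 before [x] and
   equals [Lam x] at [x]. *)
move=> Fx; have /Qplus_lt[y] : (Qplus Lam F < (x + e)%:E)%E.
  by apply: le_lt_trans Fx _; rewrite lte_fin ltrDl.
rewrite lte_fin two_step_cdfE /two_step => ye; rewrite ye.
case: (ltgtP y x) => [_|xy|->]; rewrite ?ltxx//; first by rewrite ltNge Lam_ge0.
by move=> Lyx; exists y; rewrite // xy.
Qed.

(** If [l < c < Lam s], the two-step cdfs jumping to [c] at [v n] have quantile at most [s]. Right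
    lower semicontinuity keeps [Lam] above [c] just after [s], so their limit has a quantile beyond
    [s]. *)
Lemma lsc_left_lsc (v : nat -> R) (s l : R) :
  weakly_lsc (Qplus Lam) -> right_lsc Lam ->
  v n @[n --> \oo] --> s -> (forall n, v n <= s) ->
  (forall n, Lam (v n) <= l) -> Lam s <= l.
Proof.
move=> lsc rlsc vs v_le Lvl; rewrite leNgt; apply/negP => ls.
have l0 : 0 <= l by apply: le_trans (Lvl 0).
pose c := (l + Lam s) / 2.
have /andP[lc cs] : l < c < Lam s by rewrite !midf_lt.
have c0 : 0 < c by apply: le_lt_trans lc.
have c01 : 0 <= c <= 1 by rewrite ltW//= ltW// (lt_le_trans cs).
have /right_liminf_gt[d d0 cL] : (c%:E < right_liminf Lam s)%E.
  by apply: lt_le_trans (rlsc s); rewrite lte_fin.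
have sd : s < s + d by rewrite ltrDl.
have FnF := two_step_weak_cvg (c01 := c01) c0 sd vs.
have /(Qplus_lsc_le lsc FnF) : forall n,
    (Qplus Lam (two_step_cdf (v n) (s + d) c01) <= s%:E)%E.
  move=> n; apply: (@le_trans _ _ (v n)%:E); last by rewrite lee_fin.
  apply: Qplus_le; rewrite two_step_cdfE /two_step ltxx (le_lt_trans _ sd)//.
  exact: le_lt_trans lc.
move=> Fs; have /Qplus_lt[y] :
    (Qplus Lam (two_step_cdf s (s + d) c01) < (s + d)%:E)%E.
  by apply: le_lt_trans Fs _; rewrite lte_fin.
rewrite lte_fin two_step_cdfE /two_step => yd; rewrite yd.
case: (ltgtP y s) => [_|sy|->]; last by rewrite ltNge ltW.
- by rewrite ltNge Lam_ge0.
- by rewrite ltNge ltW// cL// sy.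
Qed.

(* If [Lam] climbed back to [Lam x] at [y], the last point before [y] where it
   is below an intermediate level would have no dip to its right. *)
Lemma lsc_strictly_decreasing (x y : R) :
  weakly_lsc (Qplus Lam) -> right_lsc Lam ->
  Lam x < 1 -> x < y -> Lam y < Lam x.
Proof.
move=> lsc rlsc Lx1 xy; rewrite ltNge; apply/negP => Lxy.
have yx0 : 0 < y - x by rewrite subr_gt0.
have [w] := lsc_right_dip lsc Lx1 yx0; rewrite subrKC => /andP[xw wy] Lwx.
pose S := [set v | w <= v <= y /\ Lam v <= Lam w].
have Sw : S w by split; rewrite // lexx ltW.
have supS : has_sup S.
  by split; [exists w|exists y => v [/andP[_ ->]]].
have S_le v : S v -> v <= sup S by move=> Sv; exact: sup_upper_bound.
(* Points of [S] converge to [sup S] from below, so left lower semicontinuity keeps the supremum in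
   the sublevel set. *)
have Ls : Lam (sup S) <= Lam w.
  have /choice[v vS] : forall n, exists v, S v /\ sup S - n.+1%:R^-1 < v.
    move=> n; have [|v Sv ?] := @sup_adherent _ S n.+1%:R^-1 _ supS; first by [].
    by exists v.
  apply: (@lsc_left_lsc v) => // [|n|n].
  - apply: (@squeeze_cvgr _ _ _ _ (fun n => sup S - n.+1%:R^-1) (cst (sup S))).
    + by near=> n; have [Sv /ltW ->] := vS n; exact: S_le.
    + rewrite -[X in _ --> X]subr0; apply: cvgB; first exact: cvg_cst.
      exact: cvg_harmonic.
    + exact: cvg_cst.
  - by have [Sv _] := vS n; exact: S_le.
  - by have [[_ ?] _] := vS n.
have sy : sup S < y.
  rewrite lt_neqAle ge_sup//; last by move=> v [/andP[]].
    rewrite andbT; apply: contraTneq Ls => ->.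
    by rewrite -ltNge (lt_le_trans Lwx).
  by exists w.
have Ls1 : Lam (sup S) < 1 by apply: le_lt_trans Ls _; exact: lt_trans Lx1.
have ys0 : 0 < y - sup S by rewrite subr_gt0.
(* A dip right of [sup S] and before [y] would again belong to [S]. *)
have [t] := lsc_right_dip lsc Ls1 ys0; rewrite subrKC => /andP[st ty] Lts.
have /S_le : S t.
  split; last exact/ltW/(lt_le_trans Lts).
  by rewrite (ltW ty) andbT (le_trans (S_le _ Sw))// ltW.
by rewrite leNgt st.
Unshelve. all: by end_near. Qed.

(** The threshold is the infimum of the points where [Lam] is below 1. *)
Lemma lsc_threshold : weakly_lsc (Qplus Lam) -> right_lsc Lam ->
  exists a : \bar R,
    (forall x : R, (x%:E < a)%E -> Lam x = 1) /\
    (forall x y : R, (a <= x%:E)%E -> x < y -> Lam y < Lam x).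
Proof.
move=> lsc rlsc; exists (ereal_inf [set x%:E | x in [set x | Lam x < 1]]).
split=> [x xa|x y ax xy].
  apply/eqP; rewrite eq_le Lam_le1 leNgt; apply/negP => Lx1.
  by move: xa; apply/negP; rewrite -leNgt; apply: ereal_inf_lbound; exists x.
have := Lam_le1 x; rewrite le_eqVlt => /predU1P[->|Lx1]; last first.
  exact: lsc_strictly_decreasing.
(* When [Lam x = 1], strict decrease is applied from a point [w < y] with [Lam w < 1] instead of
   from [x]. *)
have /ereal_inf_lt[_ [w /= Lw1 <-]] := le_lt_trans ax (xy : (x%:E < y%:E)%E).
rewrite lte_fin => wy; apply: (lt_trans _ Lw1).
exact: lsc_strictly_decreasing.
Qed.

End semicontinuity.

Theorem theorem5p1 (R : realType) (Lam : R -> R)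
    (Lam01 : forall x : R, 0 <= Lam x <= 1) :
  (weakly_usc (Qplus Lam) <->
     forall x : R, (right_liminf Lam x <= (Lam x)%:E)%E) /\
  (right_lsc Lam -> weakly_usc (Qplus Lam) ->
     (weakly_continuous (Qplus Lam) <->
        exists a : \bar R,
          (forall x : R, (x%:E < a)%E -> Lam x = 1) /\
          (forall x y : R, (a <= x%:E)%E -> x < y -> Lam y < Lam x))).
Proof.
split.
  by split; [exact: right_liminf_le_of_usc|exact: Qplus_weakly_usc].
move=> rlsc usc; split=> [[_ lsc]|[a [La Ldecr]]].
  exact: lsc_threshold.
by split=> //; exact: threshold_weakly_lsc La Ldecr.
Qed.
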